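(* For integers $K\ge 3$ and $1\le \ell\le K$, let $M(K,\ell)$ be the number of primitive cyclic compositions of $K$ into $\ell$ positive parts (equivalently, the number of rotation classes of compositions $(k_1,\dots,k_\ell)$ of $K$ into positive parts that are not fixed by any nontrivial cyclic rotation; computed by Möbius inversion). Define $$R(K)=2^{-K}\sum_{\ell>K/\log_2 3} M(K,\ell)\Bigl(\log_2 3-\frac{K}{\ell}\Bigr),\qquad R=\sum_{K\ge 3}R(K).$$ Then the series for $R$ converges absolutely and $R\le 0.0893<\varepsilon:=2-\log_2 3\approx 0.415$. In particular $\varepsilon/R\ge 4.65$.
   Context: The sum over $\ell$ ranges over integers $\ell$ with $K/\log_2 3<\ell\le K$. *)

(* Defs.v *)
From Stdlib Require Import Reals.
From Coquelicot Require Import Coquelicot.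
From mathcomp Require Import all_boot.

Set Implicit Arguments.
Unset Strict Implicit.
Unset Printing Implicit Defensive.

Definition composition (K l : nat) (t : l.-tuple 'I_K.+1) : bool :=
  all (fun x : 'I_K.+1 => 0 < (x : nat))%N t &&
  (sumn (map (@nat_of_ord K.+1) t) == K)%N.

Definition aperiodic (K l : nat) (t : l.-tuple 'I_K.+1) : bool :=
  [forall i : 'I_l, (0 < i)%N ==> (rot i t != t)].

Definition rot_class (K l : nat) (t : l.-tuple 'I_K.+1) : {set l.-tuple 'I_K.+1} :=
  [set [tuple of rot i t] | i : 'I_l].

Definition M (K l : nat) : nat :=
  #|[set rot_class t | t in [set t : l.-tuple 'I_K.+1 | composition t && aperiodic t]]|.

Open Scope R_scope.

Definition log2_3 : R := ln 3 / ln 2.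

Definition RK (K : nat) : R :=
  / 2 ^ K *
  sum_f_R0 (fun l => if Rlt_dec (INR K / log2_3) (INR l)
                     then INR (M K l) * (log2_3 - INR K / INR l) else 0) K.

(* Main.v *)
(** A rotation class of aperiodic compositions has exactly l elements, so
    l * M(K, l) <= C(K-1, l-1), and M(K, l) is at most the integer part of the
    quotient.  Replacing log2 3 by its convergent 485/306 (from above), this
    bounds the sum of R(K) over 3 <= K <= 112 by an integer computation giving
    0.0883.  For larger K a Chernoff bound shows that R(K) decays like
    0.97^K / K^2, and the remaining sum is at most 0.0005.  The exact value of R
    is about 0.08824; the ratio bound 4.65 requires R <= 0.08925, slightly less
    than 0.0893. *)

Require Import Defs.
From Stdlib Require Import Reals ZArith Lra.
From Coquelicot Require Import Coquelicot.
From mathcomp Require Import all_boot zify.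

Set Implicit Arguments.
Unset Strict Implicit.
Unset Printing Implicit Defensive.

Open Scope R_scope.

(** * Rotation classes of aperiodic compositions and binomial bounds on [M] *)

Section RotationClasses.

Variables (K l : nat).
Implicit Types (t : l.-tuple 'I_K.+1).

Lemma composition_rot i t : composition [tuple of rot i t] = composition t.
Proof.
rewrite /composition; congr andb; first by apply: perm_all; rewrite /= perm_rot.
congr (_ == _)%N; rewrite map_rot; apply: perm_sumn.
by rewrite perm_rot.
Qed.

Lemma aperiodic_rot i t : aperiodic t -> aperiodic [tuple of rot i t].
Proof.
move/forallP=> ap; apply/forallP=> j; apply/implyP=> j_gt0 /=.
by rewrite rot_rot (inj_eq rot_inj); apply: (implyP (ap j)).
Qed.

(** If rotations by i < j agreed, cancelling the rotation by i would make the rotation by j - i fix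
    [t]. *)
Lemma rot_aperiodic_inj t :
  aperiodic t -> injective (fun i : 'I_l => [tuple of rot i t]).
Proof.
move/forallP=> ap.
have lt_absurd (i j : 'I_l) : (i < j)%N -> rot i t = rot j t -> False.
  move=> lt_ij eq_rot.
  have lt_l : (j - i < l)%N by apply: leq_ltn_trans (ltn_ord j); apply: leq_subr.
  have /implyP := ap (Ordinal lt_l); rewrite /= subn_gt0 => /(_ lt_ij) /eqP; apply.
  apply: (@rot_inj i); rewrite -rotD ?subnKC ?(ltnW lt_ij) //.
  by rewrite size_tuple ltnW.
move=> i j /(congr1 val) /= eq_rot; apply/val_inj.
case: (ltngtP i j) => // lt_ij; exfalso.
- exact: lt_absurd lt_ij eq_rot.
- exact: lt_absurd lt_ij (esym eq_rot).
Qed.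

Lemma rot_class_sub i t : (i < l)%N -> rot_class [tuple of rot i t] \subset rot_class t.
Proof.
move=> lt_il; apply/subsetP=> _ /imsetP[j _ ->].
have l_gt0 : (0 < l)%N by apply: leq_ltn_trans lt_il.
apply/imsetP.
exists (Ordinal (ltn_pmod (j + i) l_gt0)) => //.
apply/val_inj; rewrite /= rot_add_mod ?size_tuple ?(ltnW lt_il) ?(ltnW (ltn_ord j)) //.
case: (ltngtP (j + i) l) => [lt_s|gt_s|eq_s].
- by rewrite modn_small.
- have: (j + i - l < l)%N by have := ltn_ord j; lia.
  by move=> lt_s; rewrite -{2}(subnK (ltnW gt_s)) modnDr modn_small.
(* Here the offset is l on one side and 0 on the other; both rotations are the identity. *)
- by rewrite eq_s modnn rot0 -{1}(size_tuple t) rot_size.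
Qed.

(** The missing inclusion follows by rotating back by l - i. *)
Lemma rot_class_rot i t : (i < l)%N -> rot_class [tuple of rot i t] = rot_class t.
Proof.
move=> lt_il; apply/eqP; rewrite eqEsubset rot_class_sub //=.
case: i lt_il => [|i] lt_il.
  have eq_t : [tuple of rot 0 t] = t by apply/val_inj; rewrite /= rot0.
  by rewrite eq_t.
have lt_l : (l - i.+1 < l)%N by rewrite ltn_subrL (leq_ltn_trans _ lt_il).
have eq_t : [tuple of rot (l - i.+1) [tuple of rot i.+1 t]] = t.
  apply/val_inj; rewrite /= -rotD ?size_tuple subnK ?(ltnW lt_il) //.
  by rewrite -{1}(size_tuple t) rot_size.
by rewrite -{1}eq_t rot_class_sub.
Qed.

(** The aperiodic compositions are partitioned by their class, and each fibre contains the l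
    distinct rotations of a representative. *)
Lemma M_mul_le : (l * M K l <= #|[set t : l.-tuple 'I_K.+1 | composition t]|)%N.
Proof.
rewrite /M; set S := [set t | composition t && aperiodic t].
apply: leq_trans (_ : #|S| <= _)%N; last first.
  by apply/subset_leq_card/subsetP=> t; rewrite !inE => /andP[].
rewrite -(sum1_card (mem S)) (partition_big_imset (@rot_class K l)) /=.
rewrite mulnC -sum_nat_const; apply: leq_sum => _ /imsetP[t St ->].
rewrite sum1dep_card -[X in (X <= _)%N]card_ord.
move: (St); rewrite inE => /andP[comp_t ap_t].
rewrite -cardsT -(card_imset _ (rot_aperiodic_inj ap_t)).
apply/subset_leq_card/subsetP=> _ /imsetP[i _ ->].
by rewrite !inE rot_class_rot // eqxx andbT composition_rot comp_t aperiodic_rot.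
Qed.

End RotationClasses.

(* Subtracting 1 from every part turns a composition of K into l parts into
   an l-tuple of naturals of sum K - l. *)
Lemma card_composition_le K l : (l < K)%N ->
  (#|[set t : l.+1.-tuple 'I_K.+1 | composition t]| <= 'C(K.-1, l))%N.
Proof.
move=> lt_lK.
have -> : K.-1 = (l + (K - l.+1))%N by lia.
rewrite -card_ord_partitions.
pose f (t : l.+1.-tuple 'I_K.+1) : l.+1.-tuple 'I_(K - l.+1).+1 :=
  [tuple inord (tnth t i).-1 | i < l.+1].
have compP (t : l.+1.-tuple 'I_K.+1) : composition t ->
  (forall i, 0 < tnth t i)%N /\ (\sum_(i < l.+1) (tnth t i).-1 = K - l.+1)%N.
  case/andP=> /all_tnthP pos_t /eqP sum_t; split=> //.
  rewrite sumnE big_map big_tuple in sum_t.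
  have: (\sum_(i < l.+1) (tnth t i).-1 + \sum_(i < l.+1) 1 = \sum_(i < l.+1) tnth t i)%N.
    by rewrite -big_split /=; apply: eq_bigr => i _; rewrite addn1 prednK.
  by rewrite sum1_card card_ord sum_t => /(congr1 (subn^~ l.+1)); rewrite /= addnK.
have small (t : l.+1.-tuple 'I_K.+1) i : composition t -> ((tnth t i).-1 < (K - l.+1).+1)%N.
  by case/compP=> _ <-; rewrite ltnS (bigD1 i) //= leq_addr.
have inj_f : {in [set t : l.+1.-tuple 'I_K.+1 | composition t] &, injective f}.
  move=> t u; rewrite !inE => ct cu eq_f; apply: eq_from_tnth => i.
  move/(congr1 (fun v => val (tnth v i))): eq_f; rewrite !tnth_mktuple.
  rewrite /= !inordK ?small // => eq_p; apply/val_inj => /=.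
  by rewrite -(prednK ((compP t ct).1 i)) -(prednK ((compP u cu).1 i)) eq_p.
rewrite -(card_in_imset inj_f).
apply/subset_leq_card/subsetP=> _ /imsetP[t ct ->]; rewrite inE in ct.
rewrite inE big_tuple; apply/eqP; apply: etrans (compP t ct).2.
by apply: eq_bigr => i _; rewrite tnth_mktuple inordK ?small.
Qed.

Lemma M_mul_le_bin K l : (l < K)%N -> (l.+1 * M K l.+1 <= 'C(K.-1, l))%N.
Proof. by move=> lt_lK; apply: leq_trans (M_mul_le _ _) (card_composition_le lt_lK). Qed.

(** The identity K C(K-1, l-1) = l C(K, l) trades the factor l for K, which is constant when summing
    over l. *)
Lemma M_mul_le_binK K l : (0 < l <= K)%N -> (K * M K l <= 'C(K, l))%N.
Proof.
case: l => // l; case: K => // K /= lt_lK.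
rewrite -(leq_pmul2l (ltn0Sn l)) mulnCA -mul_bin_diag leq_mul2l /=.
exact: M_mul_le_bin.
Qed.

(** Witnessed by the composition (1, 2); it makes R(3), hence R, positive. *)
Lemma M32_gt0 : (0 < M 3 2)%N.
Proof.
rewrite /M card_gt0; apply/set0Pn.
pose t : 2.-tuple 'I_4 := [tuple of [:: inord 1; inord 2]].
exists (rot_class t); apply: imset_f; rewrite inE; apply/andP; split.
  by rewrite /composition /= !inordK.
apply/forallP=> -[[|[|i]] lt_i] //=.
by rewrite /rot /= eqseq_cons -val_eqE /= !inordK.
Qed.

(** * Rational bounds on [log2_3] *)

Lemma ln2_gt0 : 0 < ln 2.
Proof. by rewrite -ln_1; apply: ln_increasing; lra. Qed.

(** The power comparison is stated in [Z] so that it can be decided by computation. *)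
Lemma log2_3_le (p q : nat) : (0 < q)%N ->
  (3 ^ Z.of_nat q <= 2 ^ Z.of_nat p)%Z -> log2_3 <= IZR (Z.of_nat p) / IZR (Z.of_nat q).
Proof.
move=> q_gt0 /IZR_le; rewrite -!pow_IZR -!INR_IZR_INZ => le_pow.
have ln2 := ln2_gt0.
have q_pos : 0 < INR q by apply: lt_0_INR; apply/ltP.
have le_ln : INR q * ln 3 <= INR p * ln 2.
  by rewrite -!ln_pow; try lra; apply: ln_le => //; apply: pow_lt; lra.
apply: (Rmult_le_reg_r (INR q * ln 2)); first exact: Rmult_lt_0_compat.
rewrite /log2_3.
have -> : ln 3 / ln 2 * (INR q * ln 2) = INR q * ln 3 by field; lra.
by have -> : INR p / INR q * (INR q * ln 2) = INR p * ln 2 by field; lra.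
Qed.

Lemma log2_3_le_8_5 : log2_3 <= 8 / 5.
Proof. exact: (@log2_3_le 8 5). Qed.

Lemma log2_3_le_485_306 : log2_3 <= 485 / 306.
Proof.
have le_pow : (3 ^ Z.of_nat 306 <= 2 ^ Z.of_nat 485)%Z by apply/Z.leb_le; vm_compute.
exact (@log2_3_le 485 306 isT le_pow).
Qed.

Lemma log2_3_gt : 3 / 2 < log2_3.
Proof.
have ln2 := ln2_gt0.
have : ln (2 ^ 3) < ln (3 ^ 2) by apply: ln_increasing; lra.
rewrite !ln_pow /=; try lra; move=> lt_ln.
apply: (Rmult_lt_reg_r (ln 2)) => //; rewrite /log2_3.
have -> : ln 3 / ln 2 * ln 2 = ln 3 by field; lra.
lra.
Qed.

(** * The terms of R(K) and their sign *)

Definition RK_term (K l : nat) : R :=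
  if Rlt_dec (INR K / log2_3) (INR l)
  then INR (M K l) * (log2_3 - INR K / INR l) else 0.

Lemma RK_E K : RK K = / 2 ^ K * sum_f_R0 (RK_term K) K.
Proof. by []. Qed.

(** Case analysis on the cutoff: a term that passes it has l > 0, so K/l is a genuine quotient, and
    a positive gap. *)
Variant RK_term_spec (K l : nat) : R -> Prop :=
| RKTermPos of (0 < l)%N & INR K < log2_3 * INR l & 0 < log2_3 - INR K / INR l :
    RK_term_spec K l (INR (M K l) * (log2_3 - INR K / INR l))
| RKTermZero : RK_term_spec K l 0.

Lemma RK_termP K l : RK_term_spec K l (RK_term K l).
Proof.
rewrite /RK_term; case: Rlt_dec => [lt_l|not_lt]; last exact: RKTermZero.
have L_gt := log2_3_gt; have K_ge0 := pos_INR K.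
have l_pos : 0 < INR l.
  by apply: Rle_lt_trans lt_l; apply: Rdiv_le_0_compat; lra.
have lt_K : INR K < log2_3 * INR l.
  have -> : INR K = log2_3 * (INR K / log2_3) by field; lra.
  by apply: Rmult_lt_compat_l; lra.
have l_gt0 : (0 < l)%N by apply/ltP; apply: (INR_lt 0 l).
apply: RKTermPos => //.
apply: Rlt_Rminus; apply: (Rmult_lt_reg_r (INR l)) => //.
by have -> : INR K / INR l * INR l = INR K by field; lra.
Qed.

Lemma RK_term_ge0 K l : 0 <= RK_term K l.
Proof.
case: RK_termP => [_ _ gap|]; last by lra.
by apply: Rmult_le_pos; [exact: pos_INR | lra].
Qed.

Lemma pow2_gt0 K : 0 < 2 ^ K.
Proof. by apply: pow_lt; lra. Qed.

Lemma RK_ge0 K : 0 <= RK K.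
Proof.
rewrite RK_E; apply: Rmult_le_pos.
  by apply/Rlt_le/Rinv_0_lt_compat/pow2_gt0.
by apply: cond_pos_sum => l; apply: RK_term_ge0.
Qed.

Lemma RK3_gt0 : 0 < RK 3.
Proof.
rewrite RK_E; apply: Rmult_lt_0_compat; first exact/Rinv_0_lt_compat/pow2_gt0.
have term2 : 0 < RK_term 3 2.
  have L_gt := log2_3_gt.
  rewrite /RK_term /=; case: Rlt_dec => [lt_l|not_lt]; last first.
    case: not_lt; apply: (Rmult_lt_reg_r log2_3); first lra.
    have -> : (1 + 1 + 1) / log2_3 * log2_3 = 3 by field; lra.
    lra.
  apply: Rmult_lt_0_compat; last lra.
  by apply: lt_0_INR; apply/ltP; exact: M32_gt0.
rewrite /sum_f_R0.
have := (RK_term_ge0 3 0, RK_term_ge0 3 1, RK_term_ge0 3 3) => -[[? ?] ?].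
lra.
Qed.

(** * Geometric decay of R(K) by a Chernoff bound *)

Lemma INR_bin n k : (k <= n)%N -> INR 'C(n, k) = Binomial.C n k.
Proof.
have factE m : fact m = m`! by elim: m => // m IHm; rewrite factS -IHm.
move=> le_kn; rewrite /Binomial.C !factE -(bin_fact le_kn).
have fact_neq0 m : INR m`! <> 0 by apply/not_0_INR/eqP; rewrite -lt0n fact_gt0.
rewrite -!multE !mult_INR minusE; field.
by split; apply: fact_neq0.
Qed.

Lemma sum_bin_pow (x : R) n :
  sum_f_R0 (fun k => INR 'C(n, k) * x ^ k) n = (1 + x) ^ n.
Proof.
rewrite Rplus_comm Binomial.binomial; apply: PartSum.sum_eq => k /leP le_kn.
by rewrite INR_bin // pow1 Rmult_1_r.
Qed.

(** Bernoulli's inequality for (1 + 1/15)^n. *)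
Lemma INR_le_15_pow n : INR n <= 15 * (16 / 15) ^ n.
Proof.
have := @poly n (1 / 15); rewrite (_ : 1 + 1 / 15 = 16 / 15); last by field.
by move=> /(_ ltac:(lra)); lra.
Qed.

Lemma M_le_bin_div K l : (0 < l <= K)%N -> INR (M K l) <= INR 'C(K, l) / INR K.
Proof.
move=> lK; have K_gt0 : (0 < K)%N by case/andP: lK => /leq_trans; apply.
have K_pos : 0 < INR K by apply: lt_0_INR; apply/ltP.
apply: (Rmult_le_reg_l (INR K)) => //.
have -> : INR K * (INR 'C(K, l) / INR K) = INR 'C(K, l) by field; lra.
by rewrite -mult_INR; apply/le_INR/leP/M_mul_le_binK.
Qed.

(* Chernoff's trick: [l > 5K/8] whenever the term is nonzero, so the factor
   [8l - 5K <= 15 z^(8l - 5K)] makes the sum over all [l] binomial.  The base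
   [z = 16/15] is chosen with [z^8] close to the optimal value [5/3]. *)
Lemma RK_term_le_chernoff K l : (0 < K)%N -> (l <= K)%N ->
  RK_term K l <=
    24 / 5 / INR K ^ 2 / (16 / 15) ^ (5 * K) * (INR 'C(K, l) * ((16 / 15) ^ 8) ^ l).
Proof.
move=> K_gt0 le_lK.
have K_pos : 0 < INR K by apply: lt_0_INR; apply/ltP.
have z_pos n : 0 < (16 / 15) ^ n by apply: pow_lt; lra.
case: RK_termP => [l_gt0 lt_K gap|]; last first.
  have := Rmult_le_pos _ _ (pos_INR 'C(K, l)) (Rlt_le _ _ (pow_lt _ l (z_pos 8%N))).
  apply: Rmult_le_pos; apply: Rdiv_le_0_compat => //.
  by apply: Rdiv_le_0_compat; [lra | apply: pow_lt].
have l_pos : 0 < INR l by apply: lt_0_INR; apply/ltP.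
have L_le := log2_3_le_8_5.
have lt_K85 : INR K < 8 / 5 * INR l.
  by apply: Rlt_le_trans lt_K _; apply: Rmult_le_compat_r; lra.
have lt_nat : (5 * K <= 8 * l)%N.
  apply/leP/INR_le; rewrite -!multE !mult_INR.
  by rewrite (INR_IZR_INZ 5%N) (INR_IZR_INZ 8%N) /=; lra.
(* The truncated subtraction is exact by [lt_nat]. *)
pose y := (8 * l - 5 * K)%N.
have y_E : INR y = 8 * INR l - 5 * INR K.
  rewrite /y -minusE minus_INR; last exact/leP.
  by rewrite -!multE !mult_INR (INR_IZR_INZ 5%N) (INR_IZR_INZ 8%N).
have pow_E : ((16 / 15) ^ 8) ^ l = (16 / 15) ^ y * (16 / 15) ^ (5 * K).
  by rewrite -pow_mult -pow_add /y plusE subnK.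
(* The gap is at most 8/5 - K/l = y/(5l), and 1/l < 8/(5K) turns this into 8y/(25K); then y <= 15
   z^y gives the constant 24/5. *)
have gap_le : log2_3 - INR K / INR l <= 24 / 5 / INR K * (16 / 15) ^ y.
  apply: (Rle_trans _ (8 / 25 * INR y / INR K)); last first.
    apply: (Rmult_le_reg_r (INR K)) => //.
    have -> : 8 / 25 * INR y / INR K * INR K = 8 / 25 * INR y by field; lra.
    have -> : 24 / 5 / INR K * (16 / 15) ^ y * INR K = 24 / 5 * (16 / 15) ^ y by field; lra.
    by have := INR_le_15_pow y; lra.
  apply: (Rle_trans _ (8 / 5 - INR K / INR l)); first lra.
  rewrite y_E; apply: (Rmult_le_reg_r (INR l * INR K)); first exact: Rmult_lt_0_compat.
  have -> : (8 / 5 - INR K / INR l) * (INR l * INR K) = 1 / 5 * (8 * INR l - 5 * INR K) * INR K.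
    by field; lra.
  have -> : 8 / 25 * (8 * INR l - 5 * INR K) / INR K * (INR l * INR K) =
            1 / 5 * (8 * INR l - 5 * INR K) * (8 / 5 * INR l) by field; lra.
  by apply: Rmult_le_compat_l; lra.
have M_le : INR (M K l) <= INR 'C(K, l) / INR K by apply: M_le_bin_div; rewrite l_gt0.
apply: Rle_trans (_ : INR 'C(K, l) / INR K * (24 / 5 / INR K * (16 / 15) ^ y) <= _).
  by apply: Rmult_le_compat => //; [exact: pos_INR | lra].
have := z_pos (5 * K)%N => z5K.
by rewrite pow_E; apply: Req_le; field; lra.
Qed.

(** With z = 16/15, the binomial theorem sums the termwise bounds to (1 + z^8)^K, and (1 + z^8)/(2
    z^5) is about 0.969. *)
Lemma RK_le_geometric K : (0 < K)%N -> RK K <= 24 / 5 / INR K ^ 2 * (97 / 100) ^ K.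
Proof.
move=> K_gt0.
have K_pos : 0 < INR K by apply: lt_0_INR; apply/ltP.
have c_ge0 : 0 <= 24 / 5 / INR K ^ 2.
  by apply: Rdiv_le_0_compat; [lra | apply: pow_lt].
have z_pos : 0 < (16 / 15) ^ (5 * K) by apply: pow_lt; lra.
have sum_le : sum_f_R0 (RK_term K) K <=
    24 / 5 / INR K ^ 2 / (16 / 15) ^ (5 * K) * (1 + (16 / 15) ^ 8) ^ K.
  rewrite -sum_bin_pow scal_sum; apply: sum_Rle => l /leP le_lK.
  by rewrite [X in _ <= X]Rmult_comm; apply: RK_term_le_chernoff.
rewrite RK_E.
apply: (Rle_trans _ (/ 2 ^ K * (24 / 5 / INR K ^ 2 / (16 / 15) ^ (5 * K) * (1 + (16 / 15) ^ 8) ^ K))).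
  by apply: Rmult_le_compat_l sum_le; apply/Rlt_le/Rinv_0_lt_compat/pow2_gt0.
have -> : / 2 ^ K * (24 / 5 / INR K ^ 2 / (16 / 15) ^ (5 * K) * (1 + (16 / 15) ^ 8) ^ K) =
   24 / 5 / INR K ^ 2 * ((1 + (16 / 15) ^ 8) / (2 * (16 / 15) ^ 5)) ^ K.
  rewrite [X in _ = _ * X ^ K]/Rdiv Rpow_mult_distr pow_inv Rpow_mult_distr -pow_mult multE.
  field.
  by have := pow2_gt0 K; lra.
by apply: Rmult_le_compat_l => //; apply: pow_incr; lra.
Qed.

(** * Integer computation for 3 <= K <= 112 *)

Section NumericalSum.

Open Scope Z_scope.

(* With e = 2^K, this bounds 10^12 times the l-th term of R(K) when c = C(K-1, l-1):
   [d / (306 * l)] is 485/306 - K/l, and the final [+ 1] rounds the quotient up. *)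
Definition term_bound (e K l c : Z) : Z :=
  let d := 485 * l - 306 * K in
  if 0 <? d then 1000000000000 * (c / l) * d / (306 * e * l) + 1 else 0.

Fixpoint row_bound (e K l : Z) (row : seq Z) : Z :=
  if row is c :: row' then term_bound e K l c + row_bound e K (l + 1) row' else 0.

(** Pascal's rule in one pass: [a] carries the left neighbour, initially 0. *)
Fixpoint next_row (a : Z) (row : seq Z) : seq Z :=
  if row is b :: row' then (a + b) :: next_row b row' else [:: a].

(** Handles [n] consecutive values of K; [row] is meant to be row K - 1 of Pascal's triangle, whose
    first entry belongs to l = 1. *)
Fixpoint rows_bound (n K : nat) (row : seq Z) : Z :=
  if n is n'.+1 then
    row_bound (2 ^ Z.of_nat K) (Z.of_nat K) 1 row + rows_bound n' K.+1 (next_row 0 row)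
  else 0.

Definition pascal_row (n : nat) : seq Z := iter n (next_row 0) [:: 1].

Lemma size_next_row a row : size (next_row a row) = (size row).+1.
Proof. by elim: row a => //= b row IHrow a; rewrite IHrow. Qed.

Lemma size_pascal_row n : size (pascal_row n) = n.+1.
Proof. by elim: n => // n IHn; rewrite /= size_next_row IHn. Qed.

Lemma nth_next_row a row k : nth 0 (next_row a row) k = nth 0 (a :: row) k + nth 0 row k.
Proof.
elim: row a k => [|b row IHrow] a [|k] //=; first by rewrite Z.add_0_r.
by case: k.
Qed.

Lemma nth_pascal_row n k : nth 0 (pascal_row n) k = Z.of_nat 'C(n, k).
Proof.
elim: n k => [|n IHn] k; first by case: k => [|[|k]].
rewrite /= nth_next_row IHn; case: k => [|k] /=; first by rewrite !bin0.
by rewrite IHn binS addnC -plusE Nat2Z.inj_add.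
Qed.

End NumericalSum.

Lemma IZR_div_le (a b : Z) : (0 < b)%Z -> IZR a / IZR b <= IZR (a / b + 1).
Proof.
move=> b_gt0; have b_pos := IZR_lt _ _ b_gt0.
apply: (Rmult_le_reg_r (IZR b)) => //.
have -> : IZR a / IZR b * IZR b = IZR a by field; lra.
rewrite -mult_IZR; apply: IZR_le.
have := Z.mul_succ_div_gt a b b_gt0; rewrite -Z.add_1_r Z.mul_comm; exact: Z.lt_le_incl.
Qed.

Lemma RK_term_le_bound K l : (l < K)%N ->
  / 2 ^ K * RK_term K l.+1 * 1000000000000 <=
  IZR (term_bound (2 ^ Z.of_nat K) (Z.of_nat K) (Z.of_nat l.+1) (Z.of_nat 'C(K.-1, l))).
Proof.
move=> lt_lK; rewrite /term_bound.
set d := (485 * _ - _)%Z; set m := (Z.of_nat 'C(_, _) / _)%Z.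
set e := (2 ^ Z.of_nat K)%Z.
have e_E : 2 ^ K = IZR e by rewrite pow_IZR.
have e_pos : 0 < IZR e by rewrite -e_E; apply: pow2_gt0.
have l_gt0 : (0 < Z.of_nat l.+1)%Z by apply: (inj_lt 0); apply/ltP.
have l_pos := IZR_lt _ _ l_gt0.
have l_E : INR l.+1 = IZR (Z.of_nat l.+1) by exact: INR_IZR_INZ.
(* Integrality of [M] allows the quotient to be rounded down. *)
have M_le : (Z.of_nat (M K l.+1) <= m)%Z.
  apply: Z.div_le_lower_bound => //; rewrite -Nat2Z.inj_mul; apply/inj_le/leP.
  exact: M_mul_le_bin.
have d_E : IZR d = 485 * INR l.+1 - 306 * INR K.
  by rewrite minus_IZR !mult_IZR -!INR_IZR_INZ.
have L_le := log2_3_le_485_306.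
(* A vanishing term may still have d > 0, so there the bound is only shown to be nonnegative. *)
case: RK_termP => [_ lt_K gap|]; last first.
  rewrite Rmult_0_r Rmult_0_l; apply: IZR_le.
  case: Z.ltb_spec => // d_gt0; apply: Z.add_nonneg_nonneg => //.
  have m_ge0 : (0 <= m)%Z by apply: Z.le_trans M_le; apply: Nat2Z.is_nonneg.
  have e_gt0 : (0 < e)%Z by apply: lt_IZR.
  by apply: Z.div_pos; [apply: Z.mul_nonneg_nonneg | ]; lia.
have d_pos : 0 < IZR d.
  have : log2_3 * INR l.+1 <= 485 / 306 * INR l.+1 by apply: Rmult_le_compat_r; lra.
  by rewrite d_E; lra.
have d_gt0 : (0 < d)%Z by apply: lt_IZR.
have e_gt0 : (0 < e)%Z by apply: lt_IZR.
case: Z.ltb_spec => [_|]; last by lia.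
apply: Rle_trans (IZR_div_le _ _); last by lia.
rewrite !mult_IZR e_E.
have -> : 1000000000000 * IZR m * IZR d / (306 * IZR e * IZR (Z.of_nat l.+1)) =
   / IZR e * (IZR m * (485 / 306 - INR K / INR l.+1)) * 1000000000000.
  by rewrite d_E l_E; field; lra.
apply: Rmult_le_compat_r; first lra.
apply: Rmult_le_compat_l; first exact/Rlt_le/Rinv_0_lt_compat.
apply: Rmult_le_compat; [exact: pos_INR | lra | | lra].
by rewrite INR_IZR_INZ; apply: IZR_le.
Qed.

(** The offset [l] makes the induction work on suffixes of a Pascal row. *)
Lemma RK_terms_le_row_bound K l c row : (l + size row < K)%N ->
  (forall j, (j <= size row)%N -> nth 0%Z (c :: row) j = Z.of_nat 'C(K.-1, l + j)) ->
  / 2 ^ K * sum_f_R0 (fun j => RK_term K (l + j).+1) (size row) * 1000000000000 <=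
  IZR (row_bound (2 ^ Z.of_nat K) (Z.of_nat K) (Z.of_nat l.+1) (c :: row)).
Proof.
elim: row c l => [|c' row IHrow] c l lt_K nthE.
  have {nthE} := nthE 0%N isT; rewrite /= !addn0 in lt_K * => ->.
  by rewrite Z.add_0_r; apply: RK_term_le_bound.
rewrite decomp_sum; last exact/ltP.
have := nthE 0%N isT; rewrite [nth _ _ _]/= addn0 => ->.
rewrite [row_bound _ _ _ _]/= plus_IZR Rmult_plus_distr_l Rmult_plus_distr_r.
apply: Rplus_le_compat.
  by apply: RK_term_le_bound; apply: leq_ltn_trans lt_K; apply: leq_addr.
have lt_K' : (l.+1 + size row < K)%N by rewrite addSnnS.
have /(IHrow c' _ lt_K') : forall j, (j <= size row)%N ->
    nth 0%Z (c' :: row) j = Z.of_nat 'C(K.-1, l.+1 + j).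
  by move=> j le_j; rewrite addSnnS -nthE.
have -> : Z.of_nat l.+2 = (Z.of_nat l.+1 + 1)%Z by lia.
apply: Rle_trans; apply: Req_le; congr (_ * _ * _).
by apply: PartSum.sum_eq => j _; rewrite addSnnS.
Qed.

Lemma RK_le_row_bound K :
  RK K.+1 * 1000000000000 <=
  IZR (row_bound (2 ^ Z.of_nat K.+1) (Z.of_nat K.+1) 1 (pascal_row K)).
Proof.
have := size_pascal_row K; have := @nth_pascal_row K.
case: (pascal_row K) => // c row nthE [size_row].
rewrite RK_E decomp_sum; last exact/ltP.
(* [RK] sums from l = 0, the Pascal row from l = 1. *)
have -> : RK_term K.+1 0 = 0 by case: RK_termP.
rewrite Rplus_0_l -[K.+1.-1]/K.
have := @RK_terms_le_row_bound K.+1 0 c row.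
by rewrite add0n size_row; apply => // j _; apply: nthE.
Qed.

Lemma sum_RK_le_rows_bound K n :
  sum_f_R0 (fun i => RK (K + i).+1) n * 1000000000000 <=
  IZR (rows_bound n.+1 K.+1 (pascal_row K)).
Proof.
elim: n K => [|n IHn] K.
  by rewrite [rows_bound _ _ _]/= Z.add_0_r /= addn0; apply: RK_le_row_bound.
rewrite decomp_sum; last exact/ltP.
rewrite -[rows_bound _ _ _]/(row_bound _ _ _ _ + rows_bound n.+1 K.+2 (pascal_row K.+1))%Z.
rewrite plus_IZR Rmult_plus_distr_r addn0; apply: Rplus_le_compat.
  exact: RK_le_row_bound.
apply: Rle_trans (IHn K.+1); apply: Req_le; congr (_ * _).
by apply: PartSum.sum_eq => i _; rewrite addSnnS.
Qed.

Lemma sum_RK_le : sum_f_R0 (fun n => RK (n + 3)) 109 <= 883 / 10000.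
Proof.
(* This is 0.0883 in units of 10^(-12). *)
have le_Z : (rows_bound 110 3 (pascal_row 2) <= 88300000000)%Z.
  by apply/Z.leb_le; vm_compute.
have := Rle_trans _ _ _ (@sum_RK_le_rows_bound 2 109) (IZR_le _ _ le_Z).
rewrite (PartSum.sum_eq _ (fun n => RK (n + 3))); first lra.
by move=> i _; rewrite addnC -addn1 -addnA.
Qed.

(** * Convergence, tail and final estimate *)

Lemma geom_97_100 : ex_series (pow (97 / 100)) /\ Series (pow (97 / 100)) = 100 / 3.
Proof.
have q_lt1 : Rabs (97 / 100) < 1 by rewrite Rabs_pos_eq; lra.
by split; [exact: ex_series_geom | rewrite Series_geom //; field].
Qed.

Lemma ex_series_RK : ex_series (fun n => RK (n + 3)).
Proof.
apply: (ex_series_le _ (fun n => 24 / 5 * (97 / 100) ^ n)); last first.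
  exact: (ex_series_scal_l (24 / 5) _ geom_97_100.1).
move=> n; rewrite -[norm _]/(Rabs _) Rabs_pos_eq; last exact: RK_ge0.
apply: Rle_trans (RK_le_geometric _) _; first by rewrite addn3.
have K_ge1 : 1 <= INR (n + 3) by rewrite addn3 (S_INR n.+2); have := pos_INR n.+2; lra.
apply: Rmult_le_compat.
- by apply: Rdiv_le_0_compat; [lra | apply: pow_lt; lra].
- by apply: pow_le; lra.
- rewrite -[X in _ <= X]Rdiv_1_r; apply: Rmult_le_compat_l; first lra.
  by apply: Rinv_le_contravar; [lra | apply: pow_R1_Rle].
- have qn_ge0 := pow_le (97 / 100) n ltac:(lra).
  by rewrite -plusE pow_add /=; lra.
Qed.

(** The tail starts at K = 113; bounding 1/K^2 by 1/113^2 leaves a geometric series with sum about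
    0.0004. *)
Lemma Series_RK_tail_le : Series (fun n => RK (110 + n + 3)) <= 5 / 10000.
Proof.
apply: (Rle_trans _ (Series (fun n => 24 / 5 / 113 ^ 2 * (97 / 100) ^ 113 * (97 / 100) ^ n))).
  apply: Series_le; last exact: (ex_series_scal_l _ _ geom_97_100.1).
  move=> n; split; first exact: RK_ge0.
  have -> : (110 + n + 3 = 113 + n)%N by lia.
  apply: Rle_trans (RK_le_geometric _) _ => //.
  rewrite -plusE pow_add Rmult_assoc; apply: Rmult_le_compat_r.
    by apply: Rmult_le_pos; apply: pow_le; lra.
  apply: Rmult_le_compat_l; first lra.
  apply: Rinv_le_contravar; first by apply: pow_lt; lra.
  apply: pow_incr; split; first lra.
  by rewrite plus_INR (INR_IZR_INZ 113%N) -[IZR _]/113; have := pos_INR n; lra.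
rewrite Series_scal_l geom_97_100.2; lra.
Qed.

Lemma Series_RK_le : Series (fun n => RK (n + 3)) <= 888 / 10000.
Proof.
rewrite (Series_incr_n _ 110); [|by apply/ltP|exact: ex_series_RK].
apply: Rle_trans (Rplus_le_compat _ _ _ _ sum_RK_le Series_RK_tail_le) _; lra.
Qed.

Lemma Series_RK_gt0 : 0 < Series (fun n => RK (n + 3)).
Proof.
rewrite (Series_incr_1 _ ex_series_RK); apply: Rplus_lt_le_0_compat; first exact: RK3_gt0.
(* Writing 0 as a series permits a termwise comparison. *)
rewrite -(Rmult_0_l (Series (fun n => RK (n.+1 + 3)))) -Series_scal_l.
apply: Series_le; last exact: (proj1 (ex_series_incr_1 _) ex_series_RK).
by move=> n; have := RK_ge0 (n.+1 + 3); lra.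
Qed.

(* R = sum_{K>=3} R(K) = Series (fun n => RK (n+3)); eps = 2 - log2 3. *)
Theorem mainTheorem5 :
  ex_series (fun n : nat => Rabs (RK (n + 3))) /\
  Series (fun n : nat => RK (n + 3)) <= 893 / 10000 /\
  893 / 10000 < 2 - log2_3 /\
  (2 - log2_3) / Series (fun n : nat => RK (n + 3)) >= 465 / 100.
Proof.
have S_le := Series_RK_le; have S_pos := Series_RK_gt0; have L_le := log2_3_le_485_306.
split; [|split; [lra|split; [lra|]]].
  apply: ex_series_ext ex_series_RK => n.
  by rewrite Rabs_pos_eq //; apply: RK_ge0.
(* It remains that 4.65 * 0.0888 = 0.41292 is below 2 - 485/306 = 127/306, about 0.41503. *)
apply/Rle_ge/(Rmult_le_reg_r _ _ _ S_pos).
set S := Series _ in S_pos S_le *.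
have -> : (2 - log2_3) / S * S = 2 - log2_3 by field; lra.
lra.
Qed.
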